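(* For any $n\geq 2$ the standard inclusion of symmetric groups $S_n \subset S_{n+1}$ has depth $2n-1$.
   Context: For finite groups $H\subseteq G$ let $\mathrm{Irr}(G)=\{\chi_1,\dots,\chi_s\}$ and $\mathrm{Irr}(H)=\{\psi_1,\dots,\psi_r\}$ be the irreducible complex characters; the inclusion matrix is the $r\times s$ matrix $M=(m_{ij})$ with $m_{ij}=\langle \psi_i, \chi_j\!\downarrow_H\rangle$. Powers of $M$ are understood as $M^1=M$, $M^2=MM^t$, $M^3=MM^tM$, etc., and inequalities between matrices are entrywise. The matrix $M$ satisfies a depth $n$ inequality ($n\ge 2$) if $M^{n+1}\le qM^{n-1}$ for some positive integer $q$; the depth of $H$ in $G$ is the least $n\ge 2$ for which a depth $n$ inequality holds. In the standard inclusion, $S_n$ is the subgroup of permutations in $S_{n+1}$ fixing the letter $n+1$. *)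

(* Defs.v *)
From mathcomp Require Import all_boot all_order all_algebra all_fingroup.
From mathcomp Require Import all_solvable all_field all_character.

Set Implicit Arguments.
Unset Strict Implicit.
Unset Printing Implicit Defensive.

Import GroupScope GRing.Theory Num.Theory.
Local Open Scope ring_scope.

(* The cfRes underlying 'Res[H] is the restriction only when H \subset G;     *)
(* otherwise its value is a library default.                                  *)
Definition inclusion_mx (gT : finGroupType) (H G : {group gT}) :
    'M[algC]_(Nirr H, Nirr G) :=
  \matrix_(i, j) '['chi[H]_i, 'Res[H] 'chi[G]_j].

(* The alternating powers M^1 = M, M^2 = M M^t, M^3 = M M^t M, ... are square *)
(* or rectangular according to the parity of the exponent, hence are split    *)
(* into the two families M^(2k) = (M M^t)^k and M^(2k+1) = (M M^t)^k M.       *)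
Definition even_altpow (R : pzRingType) (r s : nat) (M : 'M[R]_(r, s))
    (k : nat) : 'M[R]_r :=
  iter k (mulmx (M *m M^T)) 1%:M.

Definition odd_altpow (R : pzRingType) (r s : nat) (M : 'M[R]_(r, s))
    (k : nat) : 'M[R]_(r, s) :=
  even_altpow M k *m M.

Definition mx_le (r s : nat) (A B : 'M[algC]_(r, s)) : Prop :=
  forall i j, A i j <= B i j.

(* M^(n+1) <= q M^(n-1): both exponents are even when n is odd, and odd when  *)
(* n is even; an exponent e belongs to index e./2 of its family.              *)
Definition depth_inequality (r s : nat) (M : 'M[algC]_(r, s)) (n : nat) :
    Prop :=
  exists2 q : nat, (0 < q)%N &
    if odd n
    then mx_le (even_altpow M n.+1./2) (q%:R *: even_altpow M n.-1./2)
    else mx_le (odd_altpow M n.+1./2) (q%:R *: odd_altpow M n.-1./2).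

Definition has_depth (gT : finGroupType) (H G : {group gT}) (d : nat) : Prop :=
  [/\ (2 <= d)%N, depth_inequality (inclusion_mx H G) d
    & forall n, (2 <= n)%N -> depth_inequality (inclusion_mx H G) n ->
        (d <= n)%N].

(* S_n inside S_(n+1): the letters are 0, ..., n, so that the last letter,    *)
(* n + 1 in the usual numbering, is ord_max.                                  *)
Definition std_Sn (n : nat) : {group 'S_n.+1} := 'C[ord_max | 'P]%G.

(* Main.v *)
(* Write theta(g) for the number of letters fixed by g. Inducing a class      *)
(* function of S_n to S_(n+1) and restricting it back multiplies it by theta, *)
(* so the (i, j) entry of (M M^t)^k is <psi_i theta^k, psi_j>. For k = n - 1  *)
(* it is always positive, by the Burnside-Brauer argument, which gives the    *)
(* depth 2n - 1 inequality. At the trivial and sign characters it vanishes    *)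
(* for k <= n - 2, as n - 2 letters are fixed by some transposition of S_n;   *)
(* multiplying an inequality of smaller depth by powers of M M^t would bound  *)
(* the positive value at k = n - 1 by a multiple of the zero one at n - 2.    *)
Require Import Defs.
From mathcomp Require Import all_boot all_order all_algebra all_fingroup.
From mathcomp Require Import all_solvable all_field all_character.
From mathcomp Require Import zify.

Set Implicit Arguments.
Unset Strict Implicit.
Unset Printing Implicit Defensive.

Import Order.TTheory GroupScope GRing.Theory Num.Theory.
Local Open Scope ring_scope.

(** [even_altpow_std] turns the even powers of M into character sums weighted by powers of the
    fixed-point count, and depth becomes a question of which entries vanish: all entries are
    naturals, so an everywhere positive power dominates any other up to a constant. Positivity at k
    = n - 1 is [even_altpow_std_gt0]; the vanishing trivial-sign entry for smaller k is
    [sum_sign_num_fix]. [even_altpow_le] and [odd_altpow_le] lift any inequality of smaller depth to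
    these two exponents. *)

Section AlternatingPowers.

Variables (gT : finGroupType) (H G : {group gT}).
Hypothesis sHG : H \subset G.
Let M := inclusion_mx H G.

Lemma inclusion_mx_gram i j :
  (M *m M^T) i j = '['Res[H] ('Ind[G] 'chi[H]_i), 'chi_j].
Proof.
rewrite cfdot_Res_l cfdot_sum_irr mxE; apply: eq_bigr => k _.
(* Multiplicities are naturals, so the transpose agrees with the conjugate transpose of the inner
   product. *)
rewrite !mxE -!Frobenius_reciprocity conj_natr //.
by rewrite Cnat_cfdot_char ?cfRes_char ?irr_char.
Qed.

Lemma inclusion_mx_gram_nat i j : (M *m M^T) i j \is a Num.nat.
Proof.
by rewrite inclusion_mx_gram Cnat_cfdot_char ?cfRes_char ?cfInd_char ?irr_char.
Qed.

Lemma inclusion_mx_gram_diag i : 0 < (M *m M^T) i i.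
Proof. by rewrite inclusion_mx_gram cfdot_Res_l cfnorm_gt0 Ind_irr_neq0. Qed.

Lemma even_altpowS k : even_altpow M k.+1 = (M *m M^T) *m even_altpow M k.
Proof. by []. Qed.

Lemma even_altpow_nat k i j : even_altpow M k i j \is a Num.nat.
Proof.
elim: k i j => [|k IHk] i j; first by rewrite mxE; apply: rpred_nat.
rewrite even_altpowS mxE; apply: rpred_sum => l _.
by apply: rpredM => //; apply: inclusion_mx_gram_nat.
Qed.

(** All entries are nonnegative and the diagonal of M M^t is positive, so a positive entry stays
    positive in every higher power. *)
Lemma even_altpow_eq0_le k m i j : (k <= m)%N ->
  even_altpow M m i j = 0 -> even_altpow M k i j = 0.
Proof.
move=> /subnK <-; elim: (m - k)%N => // {}m IHm; rewrite addSn even_altpowS mxE.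
move=> Mm0; apply: IHm.
have ge0 l : 0 <= (M *m M^T) i l * even_altpow M (m + k) l j.
  by rewrite mulr_ge0 ?natr_ge0 ?inclusion_mx_gram_nat ?even_altpow_nat.
have: (M *m M^T) i i * even_altpow M (m + k) i j = 0.
  exact: (psumr_eq0P (fun l _ => ge0 l) Mm0).
by move/eqP; rewrite mulf_eq0 gt_eqF ?inclusion_mx_gram_diag //= => /eqP.
Qed.

Lemma mx_le_gram m c (A B : 'M[algC]_(Nirr H, c)) (q : algC) :
  mx_le A (q *: B) ->
  mx_le (even_altpow M m *m A) (q *: (even_altpow M m *m B)).
Proof.
move=> leAB i j; rewrite scalemxAr !mxE; apply: ler_sum => l _.
by rewrite ler_wpM2l ?natr_ge0 ?even_altpow_nat.
Qed.

Lemma even_altpowD k m :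
  even_altpow M (k + m) = even_altpow M k *m even_altpow M m.
Proof.
elim: k => [|k IHk]; first by rewrite mul1mx.
by rewrite addSn !even_altpowS IHk mulmxA.
Qed.

Lemma even_altpow_le m k l (q : algC) :
  mx_le (even_altpow M k) (q *: even_altpow M l) ->
  mx_le (even_altpow M (m + k)) (q *: even_altpow M (m + l)).
Proof. by rewrite !even_altpowD; apply: mx_le_gram. Qed.

Lemma odd_altpow_le m k l (q : algC) :
  mx_le (odd_altpow M k) (q *: odd_altpow M l) ->
  mx_le (odd_altpow M (m + k)) (q *: odd_altpow M (m + l)).
Proof. by rewrite /odd_altpow !even_altpowD -!mulmxA; apply: mx_le_gram. Qed.

End AlternatingPowers.

Definition num_fix (T : finType) (g : {perm T}) := #|[set a | g a == a]|.

Lemma num_fix1 (T : finType) : num_fix (1%g : {perm T}) = #|T|.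
Proof. by apply: eq_card => a; rewrite !inE perm1 eqxx. Qed.

Section StandardInclusion.

Variable n : nat.
Let G := [set: 'S_n.+1]%G.
Let H := std_Sn n.
Let M := inclusion_mx H G.

Lemma std_SnP (g : 'S_n.+1) : reflect (g ord_max = ord_max) (g \in H).
Proof. by apply: (iffP astab1P); rewrite /= /aperm. Qed.

Lemma std_Sn_conj_tperm (g : 'S_n.+1) a :
  (g ^ tperm a ord_max \in H)%g = (g a == a).
Proof.
apply/std_SnP/eqP => [|ga]; rewrite conjgE tpermV !permM tpermR.
  by move=> e; apply: (@perm_inj _ (tperm a ord_max)); rewrite e tpermL.
by rewrite ga tpermL.
Qed.

(* Sort the elements y of S_(n+1) by the letter a they send to the last one:  *)
(* such y form the coset (a n+1) S_n, and g ^ y lies in S_n iff g fixes a.    *)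
Lemma cfInd_std_Sn (phi : 'CF(H)) (g : 'S_n.+1) : g \in H ->
  'Ind[G] phi g = phi g * (num_fix g)%:R.
Proof.
move=> Hg; rewrite cfIndE ?subsetT //.
rewrite (partition_big (fun y : 'S_n.+1 => y^-1%g ord_max) xpredT) //=.
rewrite (eq_bigr (fun a => #|H|%:R * (if g a == a then phi g else 0)));
  last move=> a _.
  rewrite -mulr_sumr mulKf ?neq0CG // -big_mkcond /= sumr_const.
  by rewrite mulr_natr /num_fix cardsE.
rewrite (reindex_inj (mulgI (tperm a ord_max))) /=.
transitivity (\sum_(z in H) phi (g ^ tperm a ord_max)%g).
  apply: eq_big => [z | z].
    rewrite inE invMg tpermV permM -[RHS]groupV /=.
    rewrite -(inj_eq (@perm_inj _ (tperm a ord_max))) tpermK tpermL.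
    by apply/eqP/std_SnP.
  rewrite inE invMg tpermV permM /= => zH.
  have Hz : z \in H.
    rewrite -groupV; apply/std_SnP/(@perm_inj _ (tperm a ord_max)).
    by rewrite (eqP zH) tpermR.
  by rewrite conjgM cfunJ.
rewrite sumr_const -[LHS]mulr_natl; congr (_ * _).
case: ifP => [/eqP ga | gaF]; last by rewrite cfun0 // std_Sn_conj_tperm gaF.
(* Since [g] fixes both [a] and the last letter, it commutes with their transposition. *)
congr (phi _); apply/conjg_fixP; rewrite commg1_sym; apply/conjg_fixP.
by rewrite tpermJ ga (std_SnP g Hg).
Qed.

(** Each factor M M^t expands Res Ind of ['chi_i] in the irreducibles of H, which amounts to one
    more factor [num_fix]. *)
Lemma even_altpow_std k i j :
  even_altpow M k i j = #|H|%:R^-1 *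
    \sum_(g in H) 'chi_i g * (num_fix g)%:R ^+ k * ('chi_j g)^*.
Proof.
elim: k i => [|k IHk] i.
  by rewrite mxE -cfdot_irr cfdotE; under [in RHS]eq_bigr do rewrite mulr1.
rewrite even_altpowS mxE.
under eq_bigr => l _ do rewrite IHk mulrCA mulr_sumr.
rewrite -mulr_sumr exchange_big /=; congr (_ * _); apply: eq_bigr => g Hg.
under eq_bigr => l _ do rewrite inclusion_mx_gram ?subsetT // !mulrA.
rewrite -!mulr_suml exprS !mulrA; congr (_ * _ * _).
rewrite -cfInd_std_Sn // -(cfResE ('Ind[G] 'chi_i) (subsetT H) Hg).
rewrite [in RHS](cfun_sum_cfdot ('Res[H] ('Ind[G] 'chi_i))) sum_cfunE.
by apply: eq_bigr => l _; rewrite cfunE.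
Qed.

Lemma num_fix_std_Sn_gt0 g : g \in H -> (0 < num_fix g)%N.
Proof.
by move=> /std_SnP Hg; apply/card_gt0P; exists ord_max; rewrite inE Hg.
Qed.

(** If [g] moves a, it also moves g(a), leaving at most n - 1 of the n + 1 letters fixed. *)
Lemma num_fix_max (g : 'S_n.+1) : (n <= num_fix g)%N -> g = 1%g.
Proof.
move=> le_n; apply/permP => a; rewrite perm1; apply/eqP.
apply: contraLR le_n => ga; rewrite -ltnNge.
have /subset_leq_card : [set b | g b == b] \subset ~: [set a; g a].
  apply/subsetP => b; rewrite !inE negb_or => gb; apply/andP; split.
    by apply: contraTneq gb => ->.
  by apply: contraTneq gb => ->; rewrite (inj_eq perm_inj).
have := max_card (mem [set a; g a]); rewrite cards2 card_ord eq_sym ga => n_ge1.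
move=> /leq_ltn_trans; apply; rewrite cardsCs setCK cards2 card_ord eq_sym ga.
lia.
Qed.

(* Burnside-Brauer: the fixed-point count takes at most n values on S_n, so a *)
(* polynomial of degree n - 1 in it is a multiple of the regular character.   *)
Lemma even_altpow_std_gt0 i j : (0 < n)%N -> 0 < even_altpow M n.-1 i j.
Proof.
move=> n_gt0; rewrite natr_gt0 ?even_altpow_nat ?subsetT //; apply/eqP => M0.
have Mk0 k : (k < n)%N -> even_altpow M k i j = 0.
  by move=> ltkn; apply: even_altpow_eq0_le M0; rewrite ?subsetT // -ltnS prednK.
pose P : {poly algC} := \prod_(1 <= m < n) ('X - m%:R%:P).
have szP : size P = n by rewrite size_prod_XsubC size_iota subn1 prednK.
have: \sum_(k < n) P`_k * even_altpow M k i j = 0.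
  by apply: big1 => k _; rewrite Mk0 ?mulr0.
under eq_bigr => k _ do rewrite even_altpow_std mulrCA mulr_sumr.
have Pg g : \sum_(k < n) P`_k * ('chi_i g * (num_fix g)%:R ^+ k * ('chi_j g)^*)
            = 'chi_i g * ('chi_j g)^* * P.[(num_fix g)%:R].
  rewrite horner_coef szP mulr_sumr; apply: eq_bigr => k _.
  by rewrite [RHS]mulrCA [in LHS]mulrAC.
rewrite -mulr_sumr exchange_big /=.
under eq_bigr => g _ do rewrite Pg.
(* The roots 1, ..., n - 1 of [P] cover the fixed-point counts of all non-identity elements of H,
   but not n + 1, so only the identity contributes. *)
rewrite (bigD1 1%g) ?group1 //= big1 => [|g /andP[Hg g_neq1]].
  rewrite addr0; apply/eqP; rewrite mulf_neq0 ?invr_eq0 ?neq0CG //.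
  rewrite !mulf_neq0 ?conjC_eq0 ?irr1_neq0 // horner_prod.
  rewrite prodf_seq_neq0; apply/allP => m /=.
  rewrite mem_index_iota => /andP[_ ltmn].
  by rewrite hornerXsubC subr_eq0 eqr_nat num_fix1 card_ord gtn_eqF // ltnW.
have lt_fix : (num_fix g < n)%N.
  by rewrite ltnNge; apply: contra g_neq1 => /num_fix_max->.
rewrite horner_prod (bigD1_seq (num_fix g)) ?iota_uniq //=.
  by rewrite hornerXsubC subrr mul0r mulr0.
by rewrite mem_index_iota num_fix_std_Sn_gt0.
Qed.

(* Expanding the power over the maps f from k to the letters, the terms of f  *)
(* cancel in pairs under multiplication by a transposition of two letters     *)
(* avoiding both the image of f and the last letter.                          *)
Lemma sum_sign_num_fix k : (k.+1 < n)%N ->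
  \sum_(g in H) (num_fix g)%:R ^+ k * (-1) ^+ g = 0 :> algC.
Proof.
move=> ltkn.
have fixE (g : 'S_n.+1) : (num_fix g)%:R ^+ k
    = \sum_(f : {ffun 'I_k -> 'I_n.+1}) \prod_i (g (f i) == f i)%:R :> algC.
  rewrite -(bigA_distr_bigA (fun (_ : 'I_k) a => (g a == a)%:R)).
  rewrite prodr_const card_ord; congr (_ ^+ _).
  rewrite /num_fix -sum1_card natr_sum big_mkcond; apply: eq_bigr => a _.
  by rewrite inE; case: eqP.
under eq_bigr => g _ do rewrite fixE mulr_suml.
rewrite exchange_big big1 //= => f _.
have /card_gt1P[a [b []]] : (1 < #|~: (ord_max |: [set f i | i : 'I_k])|)%N.
  have: (#|ord_max |: [set f i | i : 'I_k]| <= k.+1)%N.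
    rewrite cardsU1; apply: (leq_add (leq_b1 _)).
    by rewrite (leq_trans (leq_imset_card _ _)) ?card_ord.
  move=> leA; rewrite cardsCs setCK card_ord.
  by rewrite ltn_subRL addn1 ltnS (leq_ltn_trans leA).
rewrite !inE !negb_or => /andP[a_max a_f] /andP[b_max b_f] neq_ab.
have Ht : tperm a b \in H by apply/std_SnP; rewrite tpermD.
have tf i : tperm a b (f i) = f i.
  rewrite tpermD //; [apply: contraNneq a_f | apply: contraNneq b_f] => ->.
    by rewrite imset_f.
  by rewrite imset_f.
apply/eqP; rewrite -eqNr; apply/eqP.
rewrite [RHS](reindex_inj (mulgI (tperm a b))) -sumrN /=.
apply: eq_big => [g | g _]; first by rewrite groupMl.
rewrite odd_mul_tperm neq_ab signr_addb mulN1r mulrN; congr (- (_ * _)).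
by apply: eq_bigr => i _; rewrite permM tf.
Qed.

Definition sign_mx (g : 'S_n.+1) : 'M[algC]_1 := ((-1) ^+ g)%:M.

Lemma sign_mx_repr : mx_repr G sign_mx.
Proof.
split=> [|g h _ _]; first by rewrite /sign_mx odd_perm1.
by rewrite /sign_mx odd_permM signr_addb scalar_mxM.
Qed.

Definition sign_char := cfRepr (MxRepresentation sign_mx_repr).

Lemma sign_charE g : sign_char g = (-1) ^+ g.
Proof. by rewrite cfunE inE /= mxtrace_scalar. Qed.

Lemma sign_char_lin : sign_char \is a linear_char.
Proof. by rewrite qualifE /= cfRepr_char cfRepr1 eqxx. Qed.

End StandardInclusion.

Theorem theorem6p19 (n : nat) (hn : (2 <= n)%N) :
  has_depth (std_Sn n) [set: 'S_n.+1]%G (2 * n - 1)%N.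
Proof.
set H := std_Sn n; set G := [set: _]%G; set M := inclusion_mx H G.
have sHG : H \subset G by apply: subsetT.
have n_gt0 : (0 < n)%N by apply: ltnW.
split.
- lia.
(* The sum of all entries bounds each of them, and the entries on the other side are at least 1. *)
- pose q := (\sum_i \sum_j Num.truncn (even_altpow M n i j)).+1.
  exists q => //.
  have -> : odd (2 * n - 1) by lia.
  have -> : ((2 * n - 1).+1./2 = n)%N by lia.
  have -> : ((2 * n - 1).-1./2 = n.-1)%N by lia.
  move=> i j; rewrite mxE.
  have Mge1 : 1 <= even_altpow M n.-1 i j.
    have /natrP[m Dm] := @even_altpow_nat _ H G n.-1 i j.
    by move: (even_altpow_std_gt0 i j n_gt0); rewrite Dm ltr0n ler1n.
  rewrite (le_trans _ (ler_peMr (ler0n _ q) Mge1)) //.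
  rewrite -[leLHS]truncnK ?even_altpow_nat // ler_nat leqW //.
  by rewrite (bigD1 i) //= (bigD1 j) //= -addnA leq_addr.
move=> d d_gt1 [q q_gt0 ineq]; rewrite leqNgt; apply/negP => lt_d.
have [j0 Dj0] := irrP (lin_char_irr (sign_char_lin n)).
have [l0 Dl0] := irrP (lin_char_irr (cfRes_lin_char H (sign_char_lin n))).
have M0 : even_altpow M n.-2 0 l0 = 0.
  rewrite even_altpow_std irr0 -Dl0 -[RHS](mulr0 #|H|%:R^-1); congr (_ * _).
  rewrite -[RHS](@sum_sign_num_fix n n.-2); last by lia.
  apply: eq_bigr => g Hg.
  by rewrite cfun1E Hg mul1r cfResE // sign_charE rmorph_sign.
(* The sign character restricts to the irreducible [l0], so column [j0] of M is a unit vector and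
   odd powers reduce to even ones. *)
have odd0 k : odd_altpow M k 0 j0 = even_altpow M k 0 l0.
  rewrite mxE (bigD1 l0) //= big1 => [|l neq_l].
    by rewrite mxE -Dj0 Dl0 cfnorm_irr mulr1 addr0.
  by rewrite mxE -Dj0 Dl0 cfdot_irr (negPf neq_l) mulr0.
suff: even_altpow M n.-1 0 l0 <= q%:R * even_altpow M n.-2 0 l0.
  by rewrite M0 mulr0 => /le_gtF; rewrite even_altpow_std_gt0.
(* The two exponent indices differ by one in either parity; [lt_d] gives [d.+1./2 <= n.-1], so the
   padding subtraction is exact. *)
case: ifP ineq => [d_odd | /negbT d_even].
  move=> /(even_altpow_le (n.-1 - d.+1./2))/(_ 0 l0); rewrite [leRHS]mxE.
  have -> : (n.-1 - d.+1./2 + d.+1./2 = n.-1)%N by lia.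
  by have -> : (n.-1 - d.+1./2 + d.-1./2 = n.-2)%N by lia.
move=> /(odd_altpow_le (n.-1 - d.+1./2))/(_ 0 j0); rewrite [leRHS]mxE.
have -> : (n.-1 - d.+1./2 + d.+1./2 = n.-1)%N by lia.
have -> : (n.-1 - d.+1./2 + d.-1./2 = n.-2)%N by lia.
by rewrite !odd0.
Qed.
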